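(* Let $n\ge 1$, let $f=(f^1,\dots,f^n)\in L_n^1\times\dotsm\times L_n^n$, and let $i\neq j$ be elements of $\{1,\dots,n\}$. There is an edge between vertex $i$ and vertex $j$ in the graph $\Phi(f)$ if and only if $x_i$ does not divide any monomial of $f^j_j$ and $x_j$ does not divide any monomial of $f^i_i$.
   Context: Let $\mathbb{K}=\{0,1\}$, viewed as the field with two elements. For $1\le j\le n$, $L_n^j$ is the set of all functions $g:\mathbb{K}^n\to\mathbb{K}^n$ which are the identity on all coordinates except possibly the $j$-th, i.e. $g(x)=(x_1,\dots,x_{j-1},g_j(x),x_{j+1},\dots,x_n)$ with $g_j:\mathbb{K}^n\to\mathbb{K}$ arbitrary. $L_0^j\subset L_n^j$ is the subset of those $g$ for which $g_j(x)$ depends only on $x_j$ (so $L_0^j$ has four elements; its elements are called $0$-local functions). For $f=(f^1,\dots,f^n)\in L_n^1\times\dotsm\times L_n^n$, write $f^i_i:\mathbb{K}^n\to\mathbb{K}$ for the $i$-th coordinate function of $f^i$. Every function $\mathbb{K}^n\to\mathbb{K}$ is represented by a unique polynomial in $\mathbb{K}[x_1,\dots,x_n]$ that is a $\mathbb{K}$-linear combination of the $2^n$ squarefree monomials $x_1^{b_1}\cdots x_n^{b_n}$, $b_k\in\{0,1\}$. The monomials of $f^i_i$ are the monomials appearing with nonzero coefficient in this polynomial. The graph $\Phi(f)$ is the simple graph on the vertex set $\{1,\dots,n\}$ defined as follows. Let $\widetilde F$ be the set of all $n$-tuples $(\widetilde{f^1},\dots,\widetilde{f^n})$ which are either equal to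 $f$ or arise from $f$ by replacing one of its entries $f^k$ (for some $k$) by an element of $L_0^k$. For $i\ne j$, $(i,j)$ is an edge of $\Phi(f)$ if and only if $\widetilde{f^i}\circ\widetilde{f^j}=\widetilde{f^j}\circ\widetilde{f^i}$ for all $(\widetilde{f^1},\dots,\widetilde{f^n})\in\widetilde F$. *)

(* Defs.v *)
From mathcomp Require Import all_boot all_order all_algebra.
From mathcomp Require Import mpoly.

Set Implicit Arguments.
Unset Strict Implicit.
Unset Printing Implicit Defensive.

Import GRing.Theory.
Local Open Scope ring_scope.

(* Coordinates are indexed by 'I_n = {0, ..., n-1} rather than {1, ..., n}. *)
Definition state (n : nat) : finType := {ffun 'I_n -> 'F_2}.

Definition selfmap (n : nat) : finType := {ffun state n -> state n}.

Definition L (n : nat) (j : 'I_n) : {set selfmap n} :=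
  [set g : selfmap n | [forall x : state n, forall k, (k != j) ==> (g x k == x k)]].

Definition L0 (n : nat) (j : 'I_n) : {set selfmap n} :=
  [set g in L j | [forall x : state n, forall y : state n,
                     (x j == y j) ==> (g x j == g y j)]].

Definition coordinate (n : nat) (g : selfmap n) (j : 'I_n) :
  {ffun state n -> 'F_2} := [ffun x => g x j].

Section SquarefreeRepresentation.
Variable n : nat.
Implicit Types (p q : {mpoly 'F_2[n]}) (h : {ffun state n -> 'F_2}).

Definition squarefree p : bool :=
  all (fun m : 'X_{1..n} => [forall k, (m k <= 1)%N]) (msupp p).

Definition represents p h : bool :=
  squarefree p && [forall x : state n, p.@[x] == h x].

Let mon (B : {set 'I_n}) : 'X_{1..n} := [multinom nat_of_bool (i \in B) | i < n].
Let ind (B : {set 'I_n}) : state n := [ffun i => (i \in B)%:R].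
Let pol (c : {ffun {set 'I_n} -> 'F_2}) : {mpoly 'F_2[n]} :=
  \sum_B c B *: 'X_[mon B].

Let mon_inj : injective mon.
Proof.
move=> B C /mnmP e; apply/setP=> i; move: (e i); rewrite !mnmE.
by case: (i \in B); case: (i \in C).
Qed.

Let coef_pol c B : (pol c)@_(mon B) = c B.
Proof.
rewrite /pol raddf_sum (bigD1 B) //= linearZ /= mcoeffX eqxx mulr1.
rewrite big1 ?addr0 // => C neCB.
by rewrite linearZ /= mcoeffX (inj_eq mon_inj) (negbTE neCB) mulr0.
Qed.

Let squarefree_monE p m : squarefree p -> m \in msupp p ->
  m = mon [set i | m i != 0%N].
Proof.
move=> /allP sqf /sqf /forallP le1; apply/mnmP=> i; rewrite mnmE inE.
by case: (m i) (le1 i) => [|[]].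
Qed.

Let squarefreeE p : squarefree p -> p = pol [ffun B => p@_(mon B)].
Proof.
move=> sqf; apply/mpolyP=> m; have [[B ->]|nB] : (exists B, m = mon B) \/ ~ (exists B, m = mon B).
- have [/eqP e|ne] := boolP (m == mon [set i | m i != 0%N]).
    by left; eexists; exact: e.
  right=> -[B e]; case/eqP: ne; apply/mnmP=> i.
  by rewrite mnmE inE e mnmE; case: (i \in B).
- by rewrite coef_pol ffunE.
have -> : p@_m = 0.
  apply/eqP; rewrite mcoeff_eq0; apply/negP=> /(squarefree_monE sqf) e.
  by apply: nB; eexists; exact: e.
rewrite /pol raddf_sum big1 // => B _ /=; rewrite linearZ /= mcoeffX.
by case: eqP => [e|]; rewrite ?mulr0 //; case: nB; exists B.
Qed.

Let squarefree_pol c : squarefree (pol c).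
Proof.
apply/allP=> m; rewrite mcoeff_msupp => ne0; apply/forallP=> k.
apply: contraNT ne0 => gt1; rewrite /pol raddf_sum big1 // => B _ /=.
rewrite linearZ /= mcoeffX; case: eqP => [e|]; last by rewrite mulr0.
by move: gt1; rewrite -e mnmE; case: (k \in B).
Qed.

Let eval_pol c B : (pol c).@[ind B] = \sum_(C : {set 'I_n} | C \subset B) c C.
Proof.
rewrite /pol raddf_sum [RHS]big_mkcond; apply: eq_bigr => C _ /=.
rewrite mevalZ mevalX; case: (boolP (C \subset B)) => [sCB | /subsetPn[i iC niB]].
  rewrite big1 ?mulr1 // => i _; rewrite mnmE ffunE.
  by have [/(subsetP sCB) ->|_] := boolP (i \in C); rewrite ?expr1 ?expr0.
by rewrite (bigD1 i) //= mnmE iC ffunE (negbTE niB) expr1 mul0r mulr0.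
Qed.

Let pol_eval_inj : injective (fun c => [ffun x : state n => (pol c).@[x]]).
Proof.
move=> c d /ffunP e; apply/ffunP=> B.
have [m] := ubnP #|B|; elim: m B => // m IH B ltBm.
have := e (ind B); rewrite !ffunE !eval_pol (bigD1 B) //= [in RHS](bigD1 B) //=.
rewrite [X in _ + X = _](eq_bigr d) => [|C /andP[sCB neCB]]; first exact: addIr.
apply: IH; apply: (@leq_trans #|B|) => //; apply: proper_card.
by rewrite properEneq neCB.
Qed.

Lemma represents_exists h : exists p, represents p h.
Proof.
have [g _ gK] : bijective (fun c => [ffun x : state n => (pol c).@[x]]).
  apply: (inj_card_bij pol_eval_inj).
  have cS : #|{set 'I_n}| = #|state n|.
    by have := card_powerset [set: 'I_n]; rewrite powersetT !cardsT card_ffun card_Fp.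
  by rewrite (card_ffun (state n)) (card_ffun {set 'I_n}) cS.
exists (pol (g h)); rewrite /represents squarefree_pol; apply/forallP=> x.
by have /ffunP/(_ x) := gK h; rewrite ffunE => ->.
Qed.

Lemma represents_unique p q h : represents p h -> represents q h -> p = q.
Proof.
move=> /andP[sp /forallP ep] /andP[sq /forallP e_q].
rewrite (squarefreeE sp) (squarefreeE sq); congr pol.
apply: pol_eval_inj; apply/ffunP=> x.
by rewrite !ffunE -!squarefreeE // (eqP (ep x)) (eqP (e_q x)).
Qed.

(* The choice is immaterial by represents_unique. *)
Definition poly_of h : {mpoly 'F_2[n]} := xchoose (represents_exists h).

Lemma poly_ofP h : represents (poly_of h) h.
Proof. exact: (xchooseP (represents_exists h)). Qed.

End SquarefreeRepresentation.

Definition monomials (n : nat) (h : {ffun state n -> 'F_2}) : seq 'X_{1..n} :=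
  msupp (poly_of h).

Definition replace (n : nat) (f : {ffun 'I_n -> selfmap n}) (k : 'I_n)
    (g : selfmap n) : {ffun 'I_n -> selfmap n} :=
  [ffun l => if l == k then g else f l].

Definition Ftilde (n : nat) (f : {ffun 'I_n -> selfmap n}) :
    {set {ffun 'I_n -> selfmap n}} :=
  [set ft | (ft == f) || [exists k, exists g in L0 k, ft == replace f k g]].

(* The simple graph is encoded by its adjacency relation on the vertex set 'I_n
   (irreflexive and symmetric by the two lemmas below). *)
Definition Phi (n : nat) (f : {ffun 'I_n -> selfmap n}) : rel 'I_n :=
  fun i j => (i != j) &&
    [forall ft in Ftilde f, forall x : state n,
       ft i (ft j x) == ft j (ft i x)].

Lemma Phi_irrefl (n : nat) (f : {ffun 'I_n -> selfmap n}) : irreflexive (Phi f).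
Proof. by move=> i; rewrite /Phi eqxx. Qed.

Lemma Phi_sym (n : nat) (f : {ffun 'I_n -> selfmap n}) : ssrbool.symmetric (Phi f).
Proof.
move=> i j; rewrite /Phi eq_sym; congr (_ && _).
by apply: eq_forallb => ft; congr (_ ==> _); apply: eq_forallb => x; rewrite eq_sym.
Qed.

(* Main.v *)
Require Import Defs.
From mathcomp Require Import all_boot all_order all_algebra.
From mathcomp Require Import mpoly.

Set Implicit Arguments.
Unset Strict Implicit.
Unset Printing Implicit Defensive.

Import GRing.Theory.
Local Open Scope ring_scope.

(** The divisibility conditions say that the value of [f^j] on coordinate [j]
    ignores [x_i], and that the value of [f^i] on coordinate [i] ignores [x_j]:
    a function ignores [x_i] exactly when [x_i] divides no monomial of its
    squarefree polynomial ([independent_monomialsP]).  Indeed, deleting the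
    monomials divisible by [x_i] amounts to evaluating at [x_i = 0]; when the
    function ignores [x_i] this leaves its values unchanged, so by uniqueness of
    the squarefree polynomial there was nothing to delete.

    If each of the two maps ignores the coordinate changed by the other, they
    commute ([independent_commute]), and replacing one of them by a 0-local map
    preserves this situation, since a 0-local map looks only at its own
    coordinate.  Conversely, the constants are among the 0-local maps: commuting
    with both maps [x_j := a] forces [f^i] to ignore [x_j]
    ([Phi_independent]). *)

Section Independence.
Variable n : nat.
Implicit Types (x : state n) (i j k : 'I_n) (a : 'F_2).

Definition update x i a : state n := [ffun k => if k == i then a else x k].

Definition independent i (h : {ffun state n -> 'F_2}) : Prop :=
  forall x a, h (update x i a) = h x.

Lemma mnm1_leE i (m : 'X_{1..n}) : (U_(i) <= m)%MM = (m i != 0%N).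
Proof.
apply/mnm_lepP/idP => [/(_ i)|mi k]; first by rewrite mnm1E eqxx lt0n.
by rewrite mnm1E; case: eqP => // <-; rewrite lt0n.
Qed.

Definition drop_var i (p : {mpoly 'F_2[n]}) : {mpoly 'F_2[n]} :=
  \sum_(m <- msupp p | ~~ (U_(i) <= m)%MM) p@_m *: 'X_[m].

Lemma mem_msupp_drop_var i p m :
  m \in msupp (drop_var i p) -> m \in msupp p /\ ~~ (U_(i) <= m)%MM.
Proof.
move=> m_supp; apply/andP; apply: contraLR m_supp => m_out.
rewrite mcoeff_msupp negbK /drop_var raddf_sum /= big_seq_cond big1 // => k.
case/andP=> k_supp k_free; rewrite linearZ /= mcoeffX.
case: eqP => [ekm|_]; last by rewrite mulr0.
by case/negP: m_out; rewrite -ekm k_supp.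
Qed.

(** At [x_i = 0] the monomials divisible by [x_i] vanish and the other ones keep
    their value. *)
Lemma meval_drop_var i (p : {mpoly 'F_2[n]}) x :
  (drop_var i p).@[x] = p.@[update x i 0].
Proof.
rewrite /drop_var raddf_sum mevalE big_mkcond /=; apply: eq_bigr => m _.
rewrite mnm1_leE negbK; case: ifP => mi.
  rewrite mevalZ mevalX; congr (_ * _); apply: eq_bigr => k _.
  by rewrite ffunE; case: (eqVneq k i) => // ->; rewrite (eqP mi) !expr0.
by rewrite (bigD1 i) //= ffunE eqxx expr0n mi mul0r mulr0.
Qed.

(** If [h] ignores [x_i], then [drop_var i] of its squarefree polynomial takes
    the values [h (update x i 0) = h x], so it represents [h] as well and, by
    uniqueness, is that polynomial. *)
Lemma independent_monomialsP i (h : {ffun state n -> 'F_2}) :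
  independent i h <-> (forall m, m \in monomials h -> ~~ (U_(i) <= m)%MM).
Proof.
have repr := poly_ofP h; have /andP[sqf /forallP ev] := repr.
split=> [indep m|free x a].
  suff drop_id : drop_var i (poly_of h) = poly_of h.
    by rewrite /monomials -drop_id => /mem_msupp_drop_var[].
  apply: (represents_unique _ repr); apply/andP; split.
    by apply/allP=> k /mem_msupp_drop_var[k_supp _]; apply: (allP sqf).
  by apply/forallP=> x; rewrite meval_drop_var (eqP (ev _)) indep.
rewrite -!(eqP (ev _)) !mevalE; apply: eq_big_seq => m /free.
rewrite mnm1_leE negbK => /eqP mi; congr (_ * _); apply: eq_bigr => k _.
by rewrite ffunE; case: (eqVneq k i) => // ->; rewrite mi !expr0.
Qed.

Lemma L_update i (g : selfmap n) x : g \in L i -> g x = update x i (g x i).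
Proof.
rewrite inE => /forallP/(_ x)/forallP gL; apply/ffunP=> k; rewrite ffunE.
by case: (eqVneq k i) (gL k) => [->|_ /eqP].
Qed.

(** Both composites replace [x_i] by [g x i] and [x_j] by [h x j]: neither map
    sees what the other one has changed. *)
Lemma independent_commute i j (g h : selfmap n) x :
    i != j -> g \in L i -> h \in L j ->
    independent j (coordinate g i) -> independent i (coordinate h j) ->
  g (h x) = h (g x).
Proof.
move=> neq_ij gL hL g_indep h_indep.
have gE : g (h x) i = g x i.
  by have := g_indep x (h x j); rewrite !ffunE -L_update.
have hE : h (g x) j = h x j.
  by have := h_indep x (g x i); rewrite !ffunE -L_update.
rewrite (L_update (h x) gL) (L_update (g x) hL) gE hE.
rewrite (L_update x hL) (L_update x gL); apply/ffunP=> k; rewrite !ffunE !eqxx.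
by case: (eqVneq k i) => // ->; rewrite (negbTE neq_ij).
Qed.

Lemma L0_independent i j (g : selfmap n) :
  i != j -> g \in L0 j -> independent i (coordinate g j).
Proof.
rewrite eq_sym => neq_ji; rewrite inE => /andP[_ /forallP gloc] x a.
rewrite !ffunE; move/forallP: (gloc (update x i a)) => /(_ x).
by rewrite ffunE (negbTE neq_ji) eqxx => /eqP.
Qed.

Definition constant_map j a : selfmap n := [ffun x => update x j a].

Lemma constant_map_L0 j a : constant_map j a \in L0 j.
Proof.
rewrite !inE; apply/andP; split; apply/forallP=> x; apply/forallP=> y.
  by apply/implyP=> neq_yj; rewrite !ffunE (negbTE neq_yj).
by apply/implyP=> _; rewrite !ffunE !eqxx.
Qed.

Lemma mem_Ftilde_replace (f : {ffun 'I_n -> selfmap n}) k g :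
  g \in L0 k -> replace f k g \in Ftilde f.
Proof.
move=> gL0; rewrite inE; apply/orP; right.
by apply/existsP; exists k; apply/existsP; exists g; rewrite gL0 eqxx.
Qed.

Lemma FtildeP (f ft : {ffun 'I_n -> selfmap n}) l :
  ft \in Ftilde f -> ft l = f l \/ ft l \in L0 l.
Proof.
rewrite inE => /orP[/eqP->|/existsP[k /exists_inP[g gL0 /eqP->]]]; first by left.
by rewrite ffunE; case: (eqVneq l k) => [->|_]; [right | left].
Qed.

(** Evaluating at coordinate [i] the relation between [f i] and the maps
    [x_j := a] gives exactly the independence. *)
Lemma Phi_independent (f : {ffun 'I_n -> selfmap n}) i j :
  Phi f i j -> independent j (coordinate (f i) i).
Proof.
case/andP=> neq_ij /forall_inP comm x a.
have /forallP/(_ x)/eqP/ffunP/(_ i) :=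
  comm _ (mem_Ftilde_replace f (constant_map_L0 j a)).
by rewrite !ffunE eqxx (negbTE neq_ij) !ffunE (negbTE neq_ij).
Qed.

Lemma independent_Phi (f : {ffun 'I_n -> selfmap n}) i j :
    (forall k, f k \in L k) -> i != j ->
    independent j (coordinate (f i) i) -> independent i (coordinate (f j) j) ->
  Phi f i j.
Proof.
move=> fL neq_ij fi_indep fj_indep; rewrite /Phi neq_ij.
apply/forall_inP=> ft ftF; apply/forallP=> x; apply/eqP.
have ftL l : ft l \in L l.
  by case: (FtildeP l ftF) => [->//|]; rewrite inE => /andP[].
apply: (independent_commute _ neq_ij) => //.
  by case: (FtildeP i ftF) => [->//|]; apply: L0_independent; rewrite eq_sym.
by case: (FtildeP j ftF) => [->//|]; apply: L0_independent.
Qed.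

End Independence.

Theorem proposition2p3 (n : nat) (n_gt0 : (0 < n)%N)
    (f : {ffun 'I_n -> selfmap n}) (fL : forall k : 'I_n, f k \in L k)
    (i j : 'I_n) (neq_ij : i != j) :
  Phi f i j <->
    (forall m : 'X_{1..n}, m \in monomials (coordinate (f j) j) ->
       ~~ (U_(i) <= m)%MM) /\
    (forall m : 'X_{1..n}, m \in monomials (coordinate (f i) i) ->
       ~~ (U_(j) <= m)%MM).
Proof.
split=> [edge|[/independent_monomialsP fj /independent_monomialsP fi]].
  split; apply/independent_monomialsP; apply: Phi_independent => //.
  by rewrite Phi_sym.
exact: independent_Phi.
Qed.
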